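(* Let $\mathbb{X}$ be a complex Banach space and let $T\in \mathbb{L}(\mathbb{X}, \mathbb{X}^* )$ be bijective. Then: (i) A nonzero element $x \in \mathbb{X}$ is smooth if and only if there exists a unique (up to scalar multiplication) $z \in \mathbb{X}$ such that $z^{\perp_T} = x^{\perp}$. (ii) The space $\mathbb{X}$ is strictly convex if and only if for every $x \in \mathbb{X}$ there exists at most one (up to scalar multiplication) $z \in S_\mathbb{X}$ such that $z \perp_B x^{\perp_T}$.
   Context: $\mathbb{X}^*$ is the dual space of $\mathbb{X}$, $\mathbb{L}(\mathbb{X},\mathbb{X}^* )$ is the set of all bounded linear operators from $\mathbb{X}$ to $\mathbb{X}^*$, and $S_{\mathbb{X}}=\{x\in\mathbb{X}:\|x\|=1\}$. For $x,y\in\mathbb{X}$, $x \perp_T y$ means $Tx(y)=0$, and $x^{\perp_T}=\{y\in\mathbb{X}: x\perp_T y\}$. Birkhoff-James orthogonality: $x\perp_B y$ means $\|x+\lambda y\|\ge\|x\|$ for all $\lambda\in\mathbb{C}$; $x^{\perp}=\{y\in\mathbb{X}: x\perp_B y\}$. For a set $S\subset\mathbb{X}$, $z\perp_B S$ means $z\perp_B y$ for all $y\in S$. A nonzero $x$ is smooth if there exists a unique $f\in\mathbb{X}^*$ with $f(x)=\|f\|\|x\|$ and $\|f\|=\|x\|$. $\mathbb{X}$ is strictly convex if whenever $x,y\in S_{\mathbb{X}}$ and $(1-t)x+ty\in S_{\mathbb{X}}$ for some $t\in(0,1)$, then $x=y$. ''Unique up to scalar multiplication'' means any two such elements are nonzero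 scalar multiples of each other (in (ii), necessarily by a scalar of modulus one). *)

(* Defs.v *)
From HB Require Import structures.
From mathcomp Require Import all_boot all_order all_algebra.
From mathcomp Require Import all_classical all_reals all_analysis.
From mathcomp Require Import complex.

Set Implicit Arguments.
Unset Strict Implicit.
Unset Printing Implicit Defensive.

Import Order.TTheory GRing.Theory Num.Theory.
Import numFieldNormedType.Exports.

Local Open Scope classical_set_scope.
Local Open Scope ring_scope.
Local Open Scope complex_scope.

Section Dual.
Variables (R : realType) (X : normedModType R[i]).

Definition dual_pred : {pred X -> R[i]^o} :=
  fun f => `[< linear f /\ continuous f >].

Record dual := Dual {
  dual_fun :> X -> R[i]^o;
  dual_funP : dual_fun \in dual_pred
}.

HB.instance Definition _ := [isSub of dual for dual_fun].
HB.instance Definition _ := [Choice of dual by <:].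

Lemma dual_pred_submod_closed : submod_closed dual_pred.
Proof.
split=> [|a f g].
  rewrite unfold_in; apply/asboolP; split=> [a x y|x] /=.
    by rewrite scaler0 addr0.
  exact: cvg_cst.
rewrite !unfold_in => /asboolP[lf cf] /asboolP[lg cg].
apply/asboolP; split=> [b x y|x].
  rewrite !fctE lf lg !scalerDr !scalerA (mulrC b a).
  by rewrite addrACA.
by apply: continuousD; [apply: continuousZl_tmp; exact: cf|exact: cg].
Qed.

HB.instance Definition _ :=
  GRing.isSubmodClosed.Build R[i] (X -> R[i]^o) dual_pred
    dual_pred_submod_closed.
HB.instance Definition _ := [SubChoice_isSubLmodule of dual by <:].

Lemma dual_linear (f : dual) : linear (f : X -> R[i]^o).
Proof. by case: f => f /= /asboolP[]. Qed.

Lemma dual_continuous (f : dual) : continuous (f : X -> R[i]^o).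
Proof. by case: f => f /= /asboolP[]. Qed.

HB.instance Definition _ (f : dual) :=
  GRing.isLinear.Build R[i] X R[i]^o *:%R (f : X -> R[i]^o) (dual_linear f).

(* Norms of complex normed modules take values in [R[i]]; the supremum is taken
   over [R] and embedded back into [R[i]]. *)
Definition dual_norm (f : dual) : R[i] :=
  (sup [set complex.Re `|f x| | x in [set x : X | `|x| <= 1]])%:C.

Lemma real_of_ge0 (z : R[i]) : 0 <= z -> (complex.Re z)%:C = z.
Proof. by move=> z0; rewrite RRe_real// ger0_real. Qed.

Lemma dual_bounded (f : dual) : exists M : R[i], forall x, `|f x| <= M * `|x|.
Proof.
have /linear_bounded_continuous/linear_boundedP := @dual_continuous f.
by move=> /pinfty_ex_gt0[M _ fM]; exists M.
Qed.

Lemma dual_norm_ball (f : dual) x : `|x| <= 1 -> `|f x| <= dual_norm f.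
Proof.
move=> x1; rewrite -(real_of_ge0 (normr_ge0 (f x))) lecR.
apply: ub_le_sup; last by exists x.
have [M fM] := dual_bounded f; exists (complex.Re `|M|) => _ [y y1 <-].
rewrite -lecR !real_of_ge0//.
have [->|y0] := eqVneq y 0; first by rewrite linear0 normr0.
rewrite (le_trans (fM y))// (_ : M * `|y| = `|M| * `|y|).
  by rewrite ler_piMr.
have : 0 <= M * `|y| by rewrite (le_trans _ (fM y)).
by rewrite pmulr_lge0 ?normr_gt0// => /ger0_norm ->.
Qed.

Lemma dual_norm_ge0 (f : dual) : 0 <= dual_norm f.
Proof.
by rewrite (le_trans _ (@dual_norm_ball f 0 _))// normr0 ler01.
Qed.

Lemma dual_norm_le (f : dual) (M : R[i]) : 0 <= M ->
  (forall x, `|x| <= 1 -> `|f x| <= M) -> dual_norm f <= M.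
Proof.
move=> M0 fM; rewrite -(real_of_ge0 M0) lecR.
apply: ge_sup.
  by exists (complex.Re `|f 0|), 0 => //=; rewrite normr0 ler01.
by move=> _ [x x1 <-]; rewrite -lecR !real_of_ge0//; exact: fM.
Qed.

Lemma dual_norm_apply (f : dual) x : `|f x| <= dual_norm f * `|x|.
Proof.
have [->|x0] := eqVneq x 0; first by rewrite linear0 !normr0 mulr0.
have nx0 : 0 < `|x| by rewrite normr_gt0.
rewrite -ler_pdivrMr//.
have /(dual_norm_ball f) : `| `|x|^-1 *: x| <= 1.
  by rewrite normrZ normfV normr_id mulVf// gt_eqF.
by rewrite linearZ_LR normrZ normfV normr_id mulrC.
Qed.

Lemma dual_normD (f g : dual) : dual_norm (f + g) <= dual_norm f + dual_norm g.
Proof.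
apply: dual_norm_le; first by rewrite addr_ge0// dual_norm_ge0.
move=> x x1; rewrite (le_trans (ler_normD _ _))//.
by rewrite lerD// dual_norm_ball.
Qed.

Lemma dual_normZ_le (a : R[i]) (f : dual) :
  dual_norm (a *: f) <= `|a| * dual_norm f.
Proof.
apply: dual_norm_le; first by rewrite mulr_ge0// dual_norm_ge0.
move=> x x1; rewrite [(a *: f) x]/(a *: (f x)) normrZ.
by rewrite ler_wpM2l// dual_norm_ball.
Qed.

Lemma dual_normZ (a : R[i]) (f : dual) : dual_norm (a *: f) = `|a| * dual_norm f.
Proof.
apply/le_anti; rewrite dual_normZ_le/=.
have [->|a0] := eqVneq a 0; first by rewrite normr0 mul0r dual_norm_ge0.
rewrite -{1}[f](scalerK a0) -ler_pdivlMl ?normr_gt0//.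
by rewrite -normfV dual_normZ_le.
Qed.

Lemma dual_norm_eq0 (f : dual) : dual_norm f = 0 -> f = 0.
Proof.
move=> f0; apply/val_inj/funext => x /=.
apply/normr0_eq0/le_anti; rewrite normr_ge0 andbT.
by rewrite (le_trans (dual_norm_apply f x))// f0 mul0r.
Qed.

HB.instance Definition _ :=
  Lmodule_isNormed.Build R[i] dual dual_normD dual_normZ dual_norm_eq0.

Lemma dual_normE (f : dual) : `|f| = dual_norm f.
Proof. by []. Qed.

End Dual.

Section Orthogonality.
Variables (R : realType) (X : normedModType R[i]).

Definition unit_sphere : set X := [set x | `|x| = 1].

(* [orthoT T x y] is x \perp_T y, and [orthoT_set T x] is x^{\perp_T}. *)
Definition orthoT (T : X -> dual X) (x y : X) : Prop := T x y = 0.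

Definition orthoT_set (T : X -> dual X) (x : X) : set X :=
  [set y | orthoT T x y].

(* Birkhoff-James orthogonality: [orthoBJ x y] is x \perp_B y,
   [orthoBJ_set x] is x^\perp and [orthoBJ_to_set z S] is z \perp_B S. *)
Definition orthoBJ (x y : X) : Prop :=
  forall lambda : R[i], `|x| <= `|x + lambda *: y|.

Definition orthoBJ_set (x : X) : set X := [set y | orthoBJ x y].

Definition orthoBJ_to_set (z : X) (S : set X) : Prop :=
  forall y, S y -> orthoBJ z y.

Definition smooth_point (x : X) : Prop :=
  x != 0 /\ exists! f : dual X, f x = `|f| * `|x| /\ `|f| = `|x|.

(* On the unit sphere the scalar [c] automatically has modulus one. *)
Definition at_most_one_up_to_scalar (P : set X) : Prop :=
  forall z1 z2, P z1 -> P z2 -> exists2 c : R[i], c != 0 & z2 = c *: z1.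

Definition unique_up_to_scalar (P : set X) : Prop :=
  (exists z, P z) /\ at_most_one_up_to_scalar P.

End Orthogonality.

Definition strictly_convex_space (R : realType) (X : normedModType R[i]) : Prop :=
  forall x y : X, unit_sphere x -> unit_sphere y ->
    (exists t : R, 0 < t < 1 /\ unit_sphere ((1 - t)%:C *: x + t%:C *: y)) ->
    x = y.

(* Main.v *)
(* A functional [f] that attains its norm at [z] makes [z] Birkhoff-James
   orthogonal to the kernel of [f], and conversely [z] orthogonal to the kernel
   of [f] forces [f] to attain its norm at [z].  As [T] is bijective, the sets
   x^{\perp_T} are exactly the kernels of functionals, so both parts are
   statements about norm attainment; a kernel determines its functional up to a
   scalar.  The converse passage, from orthogonality of [x] to [y] to a
   functional supporting [x] and vanishing at [y], is a Hahn-Banach argument: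
   the quotient norm inf_a |w + a y| is a sublinear functional that agrees with
   the norm at [x], a linear functional below it touching it at [x] is found as
   a minimal sublinear functional, and its complexification is the desired
   support functional. *)
From HB Require Import structures.
Require Import Defs.
From mathcomp Require Import all_boot all_order all_algebra.
From mathcomp Require Import all_classical all_reals all_analysis.
From mathcomp Require Import complex lra.
Set Implicit Arguments.
Unset Strict Implicit.
Unset Printing Implicit Defensive.

Import Order.TTheory GRing.Theory Num.Theory.
Import numFieldNormedType.Exports.
Local Open Scope classical_set_scope.
Local Open Scope ring_scope.

(** * Sublinear functionals and the real Hahn-Banach theorem *)

Section Sublinear.
Context {R : realType} {V : lmodType R}.
Implicit Types (p q : V -> R) (x y : V).

Definition sublinear q : Prop :=
  (forall x y, q (x + y) <= q x + q y) /\
  (forall (r : R) x, 0 < r -> q (r *: x) = r * q x).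

Lemma sublinear0 q : sublinear q -> q 0 = 0.
Proof.
move=> [_ qZ]; have := qZ 2 0 ltac:(by []).
by rewrite scaler0 mulr_natl mulr2n => /eqP; rewrite -subr_eq subrr => /eqP.
Qed.

Lemma sublinear_ge q x : sublinear q -> - q (- x) <= q x.
Proof.
move=> qs; rewrite -subr_ge0 opprK -(sublinear0 qs) -(subrr x).
exact: qs.1.
Qed.

(** Shared by the tilt, the lower bound of a chain and the quotient norm. Upper estimates on the
    [F k] suffice: the reverse half of homogeneity is the same estimate for [r^-1]. *)
Lemma sublinear_inf (I : Type) (A : set I) (F : I -> V -> R) :
  A !=set0 -> (forall x, has_lbound [set F i x | i in A]) ->
  (forall i j x y, A i -> A j ->
     exists2 k, A k & F k (x + y) <= F i x + F j y) ->
  (forall i (r : R) x, A i -> 0 < r ->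
     exists2 k, A k & F k (r *: x) <= r * F i x) ->
  sublinear (fun x => inf [set F i x | i in A]).
Proof.
move=> [i0 Ai0] Flb FD FZ.
have geinf i x : A i -> inf [set F i x | i in A] <= F i x.
  by move=> Ai; apply: ge_inf => //; exists i.
have leinf x m : (forall i, A i -> m <= F i x) -> m <= inf [set F i x | i in A].
  move=> mF; apply: lb_le_inf; first by exists (F i0 x), i0.
  by move=> _ [i Ai <-]; exact: mF.
have infZ (r : R) x : 0 < r ->
    inf [set F i (r *: x) | i in A] <= r * inf [set F i x | i in A].
  move=> r0; rewrite -ler_pdivrMl//; apply: (leinf) => i Ai.
  have [k Ak Fk] := FZ i r x Ai r0.
  by rewrite ler_pdivrMl// (le_trans _ Fk)// geinf.
split=> [x y|r x r0].
  rewrite -lerBlDr; apply: (leinf) => i Ai.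
  rewrite lerBlDl -lerBlDr; apply: leinf => j Aj.
  rewrite lerBlDl; have [k Ak Fk] := FD i j x y Ai Aj.
  by rewrite (le_trans _ Fk)// geinf.
apply/le_anti; rewrite infZ//= -ler_pdivlMl//.
by rewrite -{1}(scalerK (lt0r_neq0 r0) x) infZ ?invr_gt0.
Qed.

(* A minimal [q] coincides with its tilt; the last bound then makes it
   superadditive. *)
Lemma sublinear_tilt q y : sublinear q ->
  exists q', [/\ sublinear q', forall x, q' x <= q x
    & forall x, q' x <= q (x + y) - q y].
Proof.
move=> qs; have [qD qZ] := qs.
have qZ0 (t : R) x : 0 <= t -> q (t *: x) = t * q x.
  rewrite le_eqVlt => /orP[/eqP<-|/qZ//].
  by rewrite scale0r mul0r sublinear0.
(* The tilt is the infimum of [F t] over [t >= 0]; [t = 0] gives the bound by [q] and [t = 1] the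
   bound by [q (x + y) - q y]. *)
pose F (t : R) x := q (x + t *: y) - t * q y.
have Flb x : has_lbound [set F t x | t in [set t : R | 0 <= t]].
  exists (- q (- x)) => _ [t /= t0 <-]; rewrite /F -qZ0//.
  have := qD (- x) (x + t *: y); rewrite addKr => qty.
  by rewrite lerBrDr [leLHS]addrC lerBlDl.
exists (fun x => inf [set F t x | t in [set t : R | 0 <= t]]); split.
- apply: sublinear_inf => //.
  + by exists 0 => /=.
  + move=> s t x z /= s0 t0; exists (s + t) => /=; first exact: addr_ge0.
    rewrite /F scalerDl mulrDl addrACA opprD [leRHS]addrACA lerD2r.
    exact: qD.
  + move=> s r x /= s0 r0; exists (r * s) => /=.
      exact: mulr_ge0 (ltW r0) s0.
    by rewrite /F -scalerA -scalerDr qZ// -mulrA -mulrBr.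
- move=> x; apply: ge_inf => //; exists 0 => //=.
  by rewrite /F scale0r addr0 mul0r subr0.
- move=> x; apply: ge_inf => //; exists 1 => //=.
  by rewrite /F scale1r mul1r.
Qed.

Lemma sublinear_minimal p : sublinear p ->
  exists q, [/\ sublinear q, forall x, q x <= p x
    & forall q', sublinear q' -> (forall x, q' x <= q x) -> q' = q].
Proof.
move=> ps.
pose P q := sublinear q /\ forall x, q x <= p x.
pose T := {q | P q}.
(* The order is reversed, so that a maximal element for Zorn is a minimal functional and a chain is
   bounded by its pointwise infimum. *)
pose le (a b : T) : bool := `[< forall x, sval b x <= sval a x >].
have [||||[q [qs qp]] qmin] := @Zorn T le.
- by move=> a; apply/asboolP.
- move=> a b c /asboolP ba /asboolP cb; apply/asboolP => x.
  exact: le_trans (cb x) (ba x).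
- move=> [a Pa] [b Pb] /asboolP /= ba /asboolP /= ab; apply: eq_exist.
  by apply/funext => x; apply/le_anti; rewrite ba ab.
- move=> A Atot.
  have [->|/set0P[a0 Aa0]] := eqVneq A set0.
    by exists (exist P p (conj ps (fun x => lexx (p x)))).
  pose F (a : T) := sval a.
  have Flb x : has_lbound [set F a x | a in A].
    exists (- p (- x)) => _ [[a [as_ ap]] _ <-] /=.
    by rewrite (le_trans _ (sublinear_ge x as_))// lerN2.
  have infs : sublinear (fun x => inf [set F a x | a in A]).
    apply: sublinear_inf => //; first by exists a0.
    - move=> a b x y Aa Ab.
      have [/asboolP ba|/asboolP ab] := Atot _ _ Aa Ab.
      + exists b => //; rewrite (le_trans ((svalP b).1.1 x y))//.
        by rewrite lerD2r ba.
      + exists a => //; rewrite (le_trans ((svalP a).1.1 x y))//.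
        by rewrite lerD2l ab.
    - by move=> a r x Aa r0; exists a => //; rewrite /F (svalP a).1.2.
  have infp x : inf [set F a x | a in A] <= p x.
    apply: (le_trans _ ((svalP a0).2 x)).
    by apply: ge_inf => //; exists a0.
  exists (exist P _ (conj infs infp)) => a Aa; apply/asboolP => x /=.
  by apply: ge_inf => //; exists a.
exists q; split=> // q' q's q'q.
have q'p x : q' x <= p x := le_trans (q'q x) (qp x).
have q'le : le (exist P q (conj qs qp)) (exist P q' (conj q's q'p)).
  exact/asboolP.
exact: (congr1 sval (qmin _ q'le)).
Qed.

Lemma sublinear_minimal_scalar q : sublinear q ->
  (forall q', sublinear q' -> (forall x, q' x <= q x) -> q' = q) ->
  scalar q.
Proof.
move=> qs qmin; have [qD qZ] := qs.
have addq x y : q (x + y) = q x + q y.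
  apply/le_anti; rewrite qD/=.
  have [q' [q's q'q q'y]] := sublinear_tilt y qs.
  by have := q'y x; rewrite (qmin _ q's q'q) lerBrDr.
have oppq x : q (- x) = - q x.
  by apply/eqP; rewrite -addr_eq0 addrC -addq subrr sublinear0.
move=> r x y; rewrite addq; congr (_ + _).
have [r0|r0|->] := ltgtP r 0; last 1 first.
- by rewrite scale0r mul0r sublinear0.
- by rewrite -{1}[r]opprK scaleNr oppq qZ ?oppr_gt0// mulNr opprK.
- by rewrite qZ.
Qed.

(** Tilting [p] at [x0] before minimizing forces the value there: the tilt at [- x0] is at most
    [p 0 - p x0 = - p x0], so a linear [f] below it satisfies [f x0 >= p x0]. *)
Theorem Hahn_Banach_sublinear p x0 : sublinear p ->
  exists f : V -> R, [/\ scalar f, forall x, f x <= p x & f x0 = p x0].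
Proof.
move=> ps.
have [p' [p's p'p p'x0]] := sublinear_tilt x0 ps.
have [f [fs fp' fmin]] := sublinear_minimal p's.
have fl := sublinear_minimal_scalar fs fmin.
exists f; split=> // [x|]; first exact: le_trans (fp' x) (p'p x).
apply/le_anti; rewrite (le_trans (fp' x0) (p'p x0))/=.
have := le_trans (fp' (- x0)) (p'x0 (- x0)).
have -> : f (- x0) = - f x0.
  by have := fl (-1) x0 0; rewrite addr0 sublinear0// addr0 scaleN1r mulN1r.
by rewrite addNr sublinear0// sub0r lerN2.
Qed.

End Sublinear.

(** * Passage between complex and real scalars *)

Lemma complex_eq_Re (R : rcfType) (z : R[i]) (r : R) :
  complex.Re z = r -> `|z| <= r%:C%C -> z = r%:C%C.
Proof.
move=> <- zr; have : `|z| ^+ 2 <= (complex.Re z)%:C%C ^+ 2.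
  by rewrite lerXn2r ?nnegrE// (le_trans _ zr).
rewrite -add_Re2_Im2 -rmorphXn lecR gerDl.
by case: z {zr} => a b /=; rewrite exprn_even_le0//= => /eqP->.
Qed.

(** An alias that carries the scalar action of [R], kept apart from the action of [R[i]] on [X]. *)
Definition realification (R : realType) (X : lmodType R[i]) : Type := X.

Section Realification.
Context {R : realType} {X : lmodType R[i]}.

HB.instance Definition _ := GRing.Zmodule.on (realification X).

Let scale (r : R) (x : realification X) : realification X :=
  r%:C%C *: (x : X).

Let scaleA r s v : scale r (scale s v) = scale (r * s) v.
Proof. by rewrite /scale scalerA rmorphM. Qed.

Let scale1 : left_id 1 scale.
Proof. by move=> v; rewrite /scale rmorph1 scale1r. Qed.

Let scaleDr : right_distributive scale +%R.
Proof. by move=> r u v; rewrite /scale scalerDr. Qed.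

Let scaleDl v : {morph scale^~ v : r s / r + s}.
Proof. by move=> r s; rewrite /scale rmorphD scalerDl. Qed.

HB.instance Definition _ := GRing.Zmodule_isLmodule.Build R (realification X)
  scaleA scale1 scaleDr scaleDl.

Lemma realification_scaleE (r : R) (x : realification X) :
  r *: x = r%:C%C *: (x : X).
Proof. by []. Qed.

End Realification.

(** * Complex norming functionals that vanish at an orthogonal vector *)

Section Norming.
Context {R : realType} {X : normedModType R[i]}.
Implicit Types (x y z w : X) (f g : dual X).

Definition rnorm x : R := complex.Re `|x|.

Lemma rnormE x : `|x| = (rnorm x)%:C%C.
Proof. by rewrite /rnorm real_of_ge0. Qed.

Lemma rnormD x y : rnorm (x + y) <= rnorm x + rnorm y.
Proof. by rewrite -lecR rmorphD/= -!rnormE ler_normD. Qed.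

Lemma rnormZ (r : R) x : 0 < r -> rnorm (r%:C%C *: x) = r * rnorm x.
Proof.
move=> r0; apply: complexI; rewrite -rnormE normrZ rmorphM/= -rnormE.
by rewrite ger0_norm// ler0c ltW.
Qed.

Lemma dual_applyZ f (a : R[i]) x : f (a *: x) = a * f x.
Proof. by rewrite linearZ_LR. Qed.

(* The norm of [w] in the quotient of [X] by the span of [y]. *)
Definition quotient_norm y w : R :=
  inf [set rnorm (w + a *: y) | a in [set: R[i]]].

Lemma quotient_norm_le y w a : quotient_norm y w <= rnorm (w + a *: y).
Proof.
apply: ge_inf; last by exists a.
by exists 0 => _ [b _ <-]; rewrite -ler0c -rnormE.
Qed.

Lemma sublinear_quotient_norm y :
  sublinear (quotient_norm y : realification X -> R).
Proof.
apply: sublinear_inf.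
- by exists 0.
- by move=> w; exists 0 => _ [b _ <-]; rewrite -ler0c -rnormE.
- move=> a b v w _ _; exists (a + b) => //.
  by rewrite scalerDl addrACA rnormD.
- move=> a r w _ r0; exists (r%:C%C * a) => //.
  by rewrite realification_scaleE -scalerA -scalerDr rnormZ.
Qed.

Lemma quotient_norm_orthoBJ x y : orthoBJ x y -> quotient_norm y x = rnorm x.
Proof.
move=> xy; apply/le_anti.
have := quotient_norm_le y x 0; rewrite scale0r addr0 => -> /=.
apply: lb_le_inf; first by exists (rnorm (x + 0 *: y)), 0.
by move=> _ [a _ <-]; rewrite -lecR -!rnormE.
Qed.

(* [w |-> u w - i u (i w)] is complex linear with real part [u], and rotating
   [w] so that its value becomes real bounds its modulus by [`|w|]. *)
Lemma complexification (u : realification X -> R) : scalar u ->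
  (forall w : X, u w <= rnorm w) ->
  exists f, (forall w, complex.Re (f w) = u w) /\ forall w, `|f w| <= `|w|.
Proof.
move=> ul un.
have uD v w : u (v + w) = u v + u w.
  by have := ul 1 v w; rewrite scale1r mul1r.
have u0 : u 0 = 0 by have /eqP := uD 0 0; rewrite addr0 -subr_eq subrr => /eqP.
have uZ r (w : X) : u (r%:C%C *: w) = r * u w.
  by have := ul r w 0; rewrite !addr0 u0 addr0.
have uN (w : X) : u (- w) = - u w.
  by apply/eqP; rewrite -addr_eq0 -uD addNr u0.
pose F (w : X) : R[i]^o := (u w +i* - u ('i%C *: w))%C.
have FE w : F w = (u w +i* - u ('i%C *: w))%C by [].
have FD v w : F (v + w) = F v + F w.
  by rewrite !FE scalerDr !uD opprD.
have FR r w : F (r%:C%C *: w) = r%:C%C * F w.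
  by rewrite !FE scalerA mulrC -scalerA !uZ; simpc.
have Fi w : F ('i%C *: w) = 'i%C * F w.
  rewrite !FE scalerA -expr2 sqr_i scaleN1r uN opprK; simpc.
  by [].
have FZ a w : F (a *: w) = a * F w.
  by rewrite [a]complexE scalerDl FD -scalerA Fi !FR mulrDl mulrA.
have Fl : linear F by move=> a v w; rewrite FD FZ.
pose Flin := GRing.isLinear.Build R[i] X R[i]^o *:%R F Fl.
pose G : {linear X -> R[i]^o} := HB.pack F Flin.
have Fn w : `|F w| <= `|w|.
  have [->|Fw0] := eqVneq (F w) 0; first by rewrite normr0.
  pose c := `|F w| / F w.
  have c1 : `|c| = 1 by rewrite normrM normfV normr_id mulfV// normr_eq0.
  have Fcw : F (c *: w) = `|F w|.
    by rewrite FZ divfK.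
  have : complex.Re (F (c *: w)) <= rnorm (c *: w) by rewrite FE un.
  rewrite -lecR Fcw real_of_ge0//.
  by rewrite -rnormE normrZ c1 mul1r.
have Fc : continuous F.
  apply: (linear_bounded_continuous G).1; apply/linear_boundedP.
  exists 1; split => // M M1 w; rewrite (le_trans (Fn w))//.
  by rewrite ler_peMl// ltW.
have FP : F \in @dual_pred R X by rewrite unfold_in; apply/asboolP.
by exists (Dual FP).
Qed.

Lemma norming_functional x y : orthoBJ x y ->
  exists f, [/\ forall w, `|f w| <= `|w|, f x = `|x| & f y = 0].
Proof.
move=> xy.
have [u [ul uq ux]] :=
  Hahn_Banach_sublinear (x : realification X) (sublinear_quotient_norm y).
have un (w : X) : u w <= rnorm w.
  have := quotient_norm_le y w 0; rewrite scale0r addr0.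
  exact: le_trans (uq w).
have [f [fu fn]] := complexification ul un.
exists f; split=> //.
  rewrite rnormE; apply: complex_eq_Re; last by rewrite -rnormE.
  by rewrite fu ux quotient_norm_orthoBJ.
(* The quotient norm vanishes on multiples of [y]. The factor conjugate to [f y] makes the value of
   [f] equal to the squared modulus of [f y], which is thus at most [0]. *)
have := quotient_norm_le y ((f y)^*%C *: y) (- (f y)^*%C).
rewrite scaleNr subrr /rnorm normr0 raddf0 => /(le_trans (uq _)).
rewrite -fu dual_applyZ mulrC -sqr_normc -lecR rmorph0 real_of_ge0.
  move=> fy0; apply/eqP; rewrite -normr_eq0 -sqrf_eq0.
  by rewrite eq_le fy0 exprn_ge0.
exact: exprn_ge0.
Qed.

End Norming.

(** * Birkhoff-James orthogonality, norm attainment and smoothness *)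

Section Orthogonality.
Context {R : realType} {X : normedModType R[i]}.
Implicit Types (x y z w : X) (f g : dual X).

Lemma dualZE (a : R[i]) f x : (a *: f) x = a * f x.
Proof. by []. Qed.

Lemma dual_le_norm1 f : (forall w, `|f w| <= `|w|) -> `|f| <= 1.
Proof.
by move=> fn; apply: dual_norm_le => // w w1; exact: le_trans (fn w) w1.
Qed.

(** Subtracting [(f w / f x) *: x] from [w] lands in the kernel of [f], hence in that of [g]. *)
Lemma dual_kernel_proportional f g x : f x != 0 ->
  (forall y, f y = 0 -> g y = 0) -> g = (g x / f x) *: f.
Proof.
move=> fx0 fg; apply/val_inj/funext => w; rewrite -[RHS]/(g x / f x * f w).
have : g (w - (f w / f x) *: x) = 0.
  by apply: fg; rewrite linearB/= dual_applyZ divfK// subrr.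
rewrite linearB/= dual_applyZ => /eqP; rewrite subr_eq0 => /eqP->.
by rewrite mulrC mulrCA mulrC.
Qed.

Lemma orthoBJ0 x : orthoBJ x 0.
Proof. by move=> a; rewrite scaler0 addr0. Qed.

Lemma orthoBJxx x : orthoBJ x x -> x = 0.
Proof.
move=> /(_ (-1)); rewrite scaleN1r subrr normr0 => x0.
by apply/normr0_eq0/le_anti; rewrite x0 normr_ge0.
Qed.

Lemma norming_orthoBJ f z y : f != 0 -> `|f z| = `|f| * `|z| -> f y = 0 ->
  orthoBJ z y.
Proof.
move=> f0 fz fy a; rewrite -(ler_pM2l (x := `|f|)) ?normr_gt0// -fz.
have -> : f z = f (z + a *: y).
  by rewrite linearD/= dual_applyZ fy mulr0 addr0.
exact: dual_norm_apply.
Qed.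

Lemma orthoBJ_kernel_norming f z : orthoBJ_to_set z [set y | f y = 0] ->
  `|f z| = `|f| * `|z|.
Proof.
move=> zf; apply/le_anti; rewrite dual_norm_apply/=.
have [->|z0] := eqVneq z 0; first by rewrite normr0 mulr0.
have fz0 : f z != 0.
  by apply: contra_neq z0 => /zf; exact: orthoBJxx.
rewrite -ler_pdivlMr ?normr_gt0//; apply: dual_norm_le.
  by rewrite divr_ge0.
move=> w w1; rewrite ler_pdivlMr ?normr_gt0//.
have [->|fw0] := eqVneq (f w) 0; first by rewrite normr0 mul0r.
(* With this scalar the multiples of [z] cancel in the orthogonality inequality, leaving
   [(f z / f w) *: w]; its norm is therefore at least that of [z]. *)
have /zf/(_ (f z / f w)) : f (w - (f w / f z) *: z) = 0.
  by rewrite linearB/= dual_applyZ divfK// subrr.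
rewrite scalerBr scalerA mulrA divfK// divff// scale1r addrC subrK => zw.
rewrite mulrC -ler_pdivlMr ?normr_gt0// (le_trans zw)//.
by rewrite normrZ normrM normfV ler_piMr// divr_ge0.
Qed.

Lemma support_orthoBJ x y : x != 0 -> orthoBJ x y ->
  exists f : dual X, [/\ f x = `|f| * `|x|, `|f| = `|x| & f y = 0].
Proof.
move=> x0 /norming_functional[g [gn gx gy]].
have nx0 : `|x| != 0 by rewrite normr_eq0.
have g1 : `|g| = 1.
  apply/le_anti; rewrite dual_le_norm1//=.
  rewrite -(ler_pM2r (x := `|x|)) ?normr_gt0// mul1r.
  by have := dual_norm_apply g x; rewrite gx normr_id.
have ng : `| `|x| *: g| = `|x| by rewrite normrZ normr_id g1 mulr1.
by exists (`|x| *: g); rewrite ng !dualZE gx gy mulr0.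
Qed.

Lemma support_dual_neq0 f x : x != 0 -> `|f| = `|x| -> f != 0.
Proof. by move=> x0 fx; rewrite -normr_eq0 fx normr_eq0. Qed.

(** Each [y] orthogonal to [x] comes with a support functional at [x] that kills [y]; by smoothness
    this functional is [f]. *)
Lemma smooth_orthoBJ_kernel x f : smooth_point x ->
  f x = `|f| * `|x| -> `|f| = `|x| -> [set y | f y = 0] = orthoBJ_set x.
Proof.
move=> [x0 [h [_ hu]]] fx nf; apply/seteqP; split=> y /=.
  apply: norming_orthoBJ; first exact: support_dual_neq0 nf.
  by rewrite fx normrM !normr_id.
move=> /(support_orthoBJ x0)[g [gx ng gy]].
by rewrite -(hu f (conj fx nf)) (hu g (conj gx ng)).
Qed.

Lemma orthoBJ_kernel_smooth x f : x != 0 ->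
  [set y | f y = 0] = orthoBJ_set x -> smooth_point x.
Proof.
move=> x0 fx; split=> //.
have nx0 : `|x| != 0 by rewrite normr_eq0.
have fx0 : f x != 0.
  apply: contra_neq x0 => fx0; apply: orthoBJxx.
  by have : orthoBJ_set x x by rewrite -fx.
(* Orthogonality to [0] is trivial, so this is the mere existence of a support functional. *)
have [h [hx nh _]] := support_orthoBJ x0 (orthoBJ0 x).
have supp g : g x = `|g| * `|x| -> `|g| = `|x| -> g = (`|x| ^+ 2 / f x) *: f.
  move=> gx ng; have g0 := support_dual_neq0 x0 ng.
  have gx0 : g x != 0 by rewrite gx ng mulf_neq0.
  (* The kernel of a support functional [g] consists of vectors orthogonal to [x], so it lies in the
     kernel of [f]; the value of [g] at [x] then fixes the factor. *)
  have ke : f = (f x / g x) *: g.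
    apply: dual_kernel_proportional => // y gy.
    suff : orthoBJ_set x y by rewrite -fx.
    by apply: norming_orthoBJ gy => //; rewrite gx normrM !normr_id.
  by rewrite {2}ke scalerA expr2 -{1}ng -gx mulrA divfK// divff// scale1r.
by exists h; split=> // g [gx ng]; rewrite (supp _ hx nh) (supp _ gx ng).
Qed.

End Orthogonality.

(** * Uniqueness of the representing vector up to a scalar *)

Section Proportional.
Context {R : realType} {X : normedModType R[i]} (T : {linear X -> dual X}).

Lemma orthoT_set_at_most_one (T_inj : injective T) (x : X) (x0 : x != 0) :
  at_most_one_up_to_scalar [set z | orthoT_set T z = orthoBJ_set x].
Proof.
have Tx0 z : orthoT_set T z = orthoBJ_set x -> T z x != 0.
  move=> zx; apply: contra_neq x0 => Tzx; apply: orthoBJxx.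
  by have : orthoBJ_set x x by rewrite -zx.
move=> z1 z2 /= z1x z2x; exists (T z2 x / T z1 x).
  by rewrite mulf_neq0 ?invr_eq0 ?Tx0.
apply: T_inj; rewrite linearZ_LR.
apply: dual_kernel_proportional; first exact: Tx0.
move=> y Tz1y; suff : orthoT_set T z2 y by [].
by rewrite z2x -z1x.
Qed.

End Proportional.

(** * Strict convexity and points where a functional attains its norm *)

Section StrictConvexity.
Context {R : realType} {X : normedModType R[i]}.
Implicit Types (x y z w : X) (f g : dual X).

(** At the midpoint [f] again takes the value [|f|], so the midpoint has norm at least one and lies
    on the sphere. *)
Lemma strictly_convex_norming_unique f z1 z2 : strictly_convex_space X ->
  `|z1| = 1 -> `|z2| = 1 -> f != 0 -> f z1 = `|f| -> f z2 = `|f| -> z1 = z2.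
Proof.
move=> sc n1 n2 f0 f1 f2; apply: sc => //.
exists 2^-1; split; first by rewrite invr_gt0 ltr0n invf_lt1 ?ltr1n ?ltr0n.
rewrite /unit_sphere /=.
have -> : (1 - 2^-1 : R) = 2^-1.
  by rewrite [X in X - _](splitr 1) mul1r addrK.
set c := (2^-1)%:C%C.
have c0 : 0 <= c by rewrite ler0c invr_ge0.
have cc : c + c = 1.
  by rewrite -rmorphD -[_ + _]/(2^-1 + 2^-1) -[2^-1]mul1r -splitr.
apply/le_anti/andP; split.
  by rewrite (le_trans (ler_normD _ _))// !normrZ n1 n2 !mulr1 ger0_norm// cc.
have := dual_norm_apply f (c *: z1 + c *: z2).
rewrite linearD/= !dual_applyZ f1 f2 -mulrDl cc mul1r normr_id.
by rewrite -{1}[`|f|]mulr1 ler_pM2l ?normr_gt0.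
Qed.

(** The number [1] is an extreme point of the closed unit disc: the real parts must be [1], and the
    modulus bound then kills the imaginary parts. *)
Lemma convex_combination_eq1 (t : R) (a b : R[i]) : 0 < t < 1 ->
  `|a| <= 1 -> `|b| <= 1 -> (1 - t)%:C%C * a + t%:C%C * b = 1 ->
  a = 1 /\ b = 1.
Proof.
move=> /andP[t0 t1] a1 b1 ab.
have Re1 (z : R[i]) : `|z| <= 1 -> complex.Re z <= 1.
  move=> z1; rewrite -lecR (le_trans _ z1)// (le_trans _ (normc_ge_Re z))//.
  by rewrite lecR ler_norm.
have [ra rb] : complex.Re a = 1 /\ complex.Re b = 1.
  have Ra := Re1 _ a1; have Rb := Re1 _ b1.
  have : (1 - t) * complex.Re a + t * complex.Re b = 1.
    move: ab; case: (a) (b) => [ar ai] [br bi] /(congr1 (@complex.Re R)).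
    by simpc.
  by move=> Rab; split; nra.
by split; apply: complex_eq_Re.
Qed.

End StrictConvexity.

Theorem theorem2p14 (R : realType) (X : completeNormedModType R[i])
  (T : {linear X -> dual X})
  (T_bounded : bounded_near T (nbhs (0 : X))) (T_bij : bijective T) :
  (forall x : X, x != 0 ->
     (smooth_point x <->
      unique_up_to_scalar [set z : X | orthoT_set T z = orthoBJ_set x]))
  /\
  (strictly_convex_space X <->
   forall x : X,
     at_most_one_up_to_scalar
       [set z : X | unit_sphere z /\ orthoBJ_to_set z (orthoT_set T x)]).
Proof.
have T_inj := bij_inj T_bij.
have T_surj (f : dual X) : exists z, T z = f.
  by have [S _ TS] := T_bij; exists (S f).
split=> [x x0|].
  split=> [xs|[[z zx] _]]; last exact: (orthoBJ_kernel_smooth x0 zx).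
  split; last exact: orthoT_set_at_most_one.
  have [_ [f [[fx nf] _]]] := xs; have [z zf] := T_surj f.
  by exists z; rewrite /= -(smooth_orthoBJ_kernel xs fx nf) -zf.
split=> [sc x z1 z2 [n1 z1x] [n2 z2x]|am1 x y nx ny [t [t01 nxy]]].
  have norming z : `|z| = 1 -> orthoBJ_to_set z (orthoT_set T x) ->
      `|T x z| = `|T x|.
    by move=> nz /orthoBJ_kernel_norming ->; rewrite nz mulr1.
  (* If [T x] were zero, its kernel would contain [z1], and a unit vector is not orthogonal to
     itself. *)
  have [T0|T0] := eqVneq (T x) 0.
    have : orthoBJ z1 z1 by apply: z1x; rewrite /orthoT_set/= /orthoT T0.
    move=> /orthoBJxx z10; move: n1 => /eqP.
    by rewrite z10 normr0 eq_sym oner_eq0.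
  have Tz0 z : `|T x z| = `|T x| -> T x z != 0.
    by move=> Tz; rewrite -normr_eq0 Tz normr_eq0.
  have e1 := norming _ n1 z1x; have e2 := norming _ n2 z2x.
  have c0 : T x z2 / T x z1 != 0 by rewrite mulf_neq0 ?invr_eq0 ?Tz0.
  exists (T x z2 / T x z1) => //.
  (* Rotating both vectors so that [T x] takes the same positive value makes them equal by strict
     convexity; undoing the rotations gives the factor [T x z2 / T x z1]. *)
  have rot z : `|z| = 1 -> `|T x z| = `|T x| ->
      `|(`|T x| / T x z) *: z| = 1 /\ T x ((`|T x| / T x z) *: z) = `|T x|.
    move=> nz Tz; rewrite normrZ nz mulr1 normrM normfV normr_id Tz.
    by rewrite divff ?normr_eq0// dual_applyZ divfK ?Tz0.
  have [r1 s1] := rot _ n1 e1; have [r2 s2] := rot _ n2 e2.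
  have := strictly_convex_norming_unique sc r1 r2 T0 s1 s2.
  move=> /(congr1 (fun v => (T x z2 / `|T x|) *: v)).
  by rewrite !scalerA !mulrA !divfK ?normr_eq0// divff ?Tz0// scale1r.
have [n0] : ((1 - t)%:C%C *: x + t%:C%C *: y) != 0.
  by rewrite -normr_eq0 nxy oner_eq0.
(* A functional of norm one supporting the convex combination takes the value [1] there, hence at
   [x] and [y] too. Both are then orthogonal to its kernel, and [y = c *: x] forces [c = 1]. *)
have [f [fm nf _]] := support_orthoBJ n0 (orthoBJ0 _).
rewrite nxy mulr1 in fm nf; rewrite nf in fm.
have f0 := support_dual_neq0 n0 (etrans nf (esym nxy)).
have fle z : `|z| = 1 -> `|f z| <= 1.
  by move=> nz; have := dual_norm_apply f z; rewrite -dual_normE nf nz mulr1.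
move: fm; rewrite linearD/= !dual_applyZ.
move=> /(convex_combination_eq1 t01 (fle _ nx) (fle _ ny))[fx fy].
have [w wf] := T_surj f.
have orth z : `|z| = 1 -> f z = 1 -> orthoBJ_to_set z (orthoT_set T w).
  move=> nz fz v; rewrite /orthoT_set/= /orthoT wf => fv.
  by apply: norming_orthoBJ fv => //; rewrite fz nf nz normr1 mulr1.
have [c _ yc] := am1 w x y (conj nx (orth _ nx fx)) (conj ny (orth _ ny fy)).
by move: fy; rewrite yc dual_applyZ fx mulr1 => ->; rewrite scale1r.
Qed.
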